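(* Let $\psi:\mathbb{R}^N\to\mathbb{R}\cup\{+\infty\}$ be a continuously differentiable convex function with $L_\psi$-Lipschitz continuous gradient. Let $K$ be a compact convex subset of $\mathbb{R}^N$ and let $\epsilon>0$ be such that a continuously differentiable function $\psi_\epsilon:\mathbb{R}^N\to\mathbb{R}\cup\{+\infty\}$ with $L_\epsilon$-Lipschitz continuous gradient satisfies $$\|\psi_\epsilon-\psi\|_{\ell_\infty(K)}=\sup_{x\in K}|\psi_\epsilon(x)-\psi(x)|=\epsilon .$$ For $x\in K$ define $$r(x)=\min\left\{\frac1{L_\epsilon},\ \sup\{t>0 : x-t(\nabla\psi_\epsilon(x)-\nabla\psi(x))\in K\}\right\}.$$ Then, for every $x\in K$ and all $0<t\le r(x)$, $$\|\nabla\psi_\epsilon(x)-\nabla\psi(x)\|\le 2\sqrt{\frac{\epsilon}{t}}\,\frac{1}{\sqrt{2-tL_\epsilon}} .$$ In particular, when $r(x)=\frac1{L_\epsilon}$, $$\|\nabla\psi_\epsilon(x)-\nabla\psi(x)\|\le 2\sqrt{L_\epsilon\,\epsilon} .$$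
   Context: $\|\cdot\|$ is the Euclidean norm. The supremum in the definition of $r(x)$ is $0$ if the set is empty (then there is no admissible $t$). $L_\epsilon>0$. *)

(* Defs.v *)
From HB Require Import structures.
From mathcomp Require Import all_boot all_order all_algebra.
From mathcomp Require Import all_classical all_reals all_analysis.
Set Implicit Arguments.
Unset Strict Implicit.
Unset Printing Implicit Defensive.
Import Order.TTheory GRing.Theory Num.Theory.
Import numFieldNormedType.Exports.
Local Open Scope classical_set_scope.
Local Open Scope ring_scope.

(* The library norm `|v| on 'rV[R]_N is the sup norm, which induces the same
   topology and the same notion of differentiability as the Euclidean norm. *)
Definition enorm (R : realType) (N : nat) (v : 'rV[R]_N) : R :=
  Num.sqrt (\sum_(i < N) v 0 i ^+ 2).

(* Functions into R U {+oo} have codomain \bar R and never take the value -oo. *)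
Definition never_ninfty (R : realType) (N : nat) (f : 'rV[R]_N -> \bar R) : Prop :=
  forall x, (-oo < f x)%E.

(* Differentiability at x requires f to be finite around x, so that the value
   of fine at +oo plays no role. *)
Definition ediffble (R : realType) (N : nat) (f : 'rV[R]_N -> \bar R)
    (x : 'rV[R]_N) : Prop :=
  (\forall y \near x, f y \is a fin_num) /\ differentiable (fine \o f) x.

Definition grad (R : realType) (N : nat) (f : 'rV[R]_N -> \bar R)
    (x : 'rV[R]_N) : 'rV[R]_N :=
  \row_(i < N) 'D_(delta_mx 0 i) (fine \o f) x.

Definition cont_diff (R : realType) (N : nat) (f : 'rV[R]_N -> \bar R) : Prop :=
  (forall x, ediffble f x) /\ continuous (grad f).

Definition lipschitz_grad (R : realType) (N : nat) (L : R)
    (f : 'rV[R]_N -> \bar R) : Prop :=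
  forall x y, enorm (grad f x - grad f y) <= L * enorm (x - y).

(* The library's convex_function is restricted to real-valued functions. *)
Definition econvex (R : realType) (N : nat) (f : 'rV[R]_N -> \bar R) : Prop :=
  forall (x y : 'rV[R]_N) (t : R), 0 <= t <= 1 ->
    (f (t *: x + (1 - t) *: y)%R
       <= t%:E * f x + (1 - t)%R%:E * f y)%E.

Definition dist_sup (R : realType) (N : nat) (K : set 'rV[R]_N)
    (f g : 'rV[R]_N -> \bar R) : \bar R :=
  ereal_sup [set `|f x - g x|%E | x in K].

(* The supremum may be +oo (when the gradients agree at x). All admissible t
   are positive, so the maximum with 0 only matters when there are none: it
   then replaces ereal_sup set0 = -oo by 0. *)
Definition rstep (R : realType) (N : nat) (K : set 'rV[R]_N) (Leps : R)
    (psi psi_eps : 'rV[R]_N -> \bar R) (x : 'rV[R]_N) : \bar R :=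
  mine (1 / Leps)%:E
    (maxe 0%E (ereal_sup [set t%:E | t in
       [set t : R | 0 < t /\ K (x - t *: (grad psi_eps x - grad psi x))]])).

(* Main.v *)
Require Import Defs.
From HB Require Import structures.
From mathcomp Require Import all_boot all_order all_algebra.
From mathcomp Require Import all_classical all_reals all_analysis.
From mathcomp Require Import ring lra.
Set Implicit Arguments.
Unset Strict Implicit.
Unset Printing Implicit Defensive.
Import Order.TTheory GRing.Theory Num.Theory.
Import numFieldNormedType.Exports.
Local Open Scope classical_set_scope.
Local Open Scope ring_scope.

(** Write d for the gap between the gradients of g := psi_eps and f := psi at x,
and move from x to y := x - t d.  Since the gradient of g is L-Lipschitz, g lies
below its quadratic model at x ([descent_lemma]); since f is convex, f lies
above its tangent at x ([convex_above_tangent]).  Subtracting, the linear terms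
combine into - t |d|^2, so that g - f decreases from x to y by at least
  t |d|^2 - (L / 2) t^2 |d|^2 = (t / 2) (2 - t L) |d|^2.
Both x and y lie in K, where |g - f| <= eps, so this decrease is at most 2 eps
([grad_gap_bound]); solving for |d| gives the bound, and t = 1 / L gives the
particular case.

That y lies in K for every admissible t, including the supremum itself, is
where the geometry of K enters: convexity makes the set of admissible steps an
interval starting at 0, and closedness makes it contain its supremum
([closed_convex_step]). *)

Definition edot {R : realType} {N : nat} (u v : 'rV[R]_N) : R :=
  \sum_(i < N) u 0 i * v 0 i.

Section EuclideanGeometry.
Context {R : realType} {N : nat}.
Implicit Types (u v w : 'rV[R]_N) (a : R).

Lemma edotC u v : edot u v = edot v u.
Proof. by apply: eq_bigr => i _; rewrite mulrC. Qed.

Lemma edotBl u v w : edot (u - v) w = edot u w - edot v w.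
Proof. by rewrite -sumrB; apply: eq_bigr => i _; rewrite !mxE mulrBl. Qed.

Lemma edotZr a u v : edot u (a *: v) = a * edot u v.
Proof. by rewrite mulr_sumr; apply: eq_bigr => i _; rewrite !mxE mulrCA. Qed.

Lemma edotZl a u v : edot (a *: u) v = a * edot u v.
Proof. by rewrite edotC edotZr edotC. Qed.

Lemma edot_ge0 u : 0 <= edot u u.
Proof. by apply: sumr_ge0 => i _; rewrite -expr2 sqr_ge0. Qed.

Lemma enormE u : enorm u = Num.sqrt (edot u u).
Proof. by congr Num.sqrt; apply: eq_bigr => i _; rewrite expr2. Qed.

Lemma enorm_ge0 u : 0 <= enorm u.
Proof. exact: sqrtr_ge0. Qed.

Lemma sqr_enorm u : enorm u ^+ 2 = edot u u.
Proof. by rewrite enormE sqr_sqrtr ?edot_ge0. Qed.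

Lemma enormZ a u : 0 <= a -> enorm (a *: u) = a * enorm u.
Proof.
move=> a0; rewrite !enormE edotZr edotZl mulrA sqrtrM -expr2 ?sqr_ge0//.
by rewrite sqrtr_sqr ger0_norm.
Qed.

Lemma edot_eq0 u : edot u u = 0 -> u = 0.
Proof.
move=> /eqP; rewrite psumr_eq0 => [/allP u0|i _]; last by rewrite -expr2 sqr_ge0.
apply/rowP => i; have := u0 i (mem_index_enum _).
by rewrite !mxE -expr2 sqrf_eq0 => /eqP.
Qed.

(** Cauchy-Schwarz, from the nonnegativity of the squared norm of
|v|^2 u - (u . v) v, which is |v|^2 (|u|^2 |v|^2 - (u . v)^2). *)
Lemma edot_le_enormM u v : edot u v <= enorm u * enorm v.
Proof.
have [v0|v0] := eqVneq (edot v v) 0.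
  rewrite (edot_eq0 v0) -(scale0r v) edotZr mul0r.
  by rewrite mulr_ge0 ?enorm_ge0.
have vgt0 : 0 < edot v v by rewrite lt_neqAle eq_sym v0 edot_ge0.
have sq : edot u v ^+ 2 <= edot u u * edot v v.
  have := edot_ge0 (edot v v *: u - edot u v *: v).
  rewrite !(edotBl, edotZl, edotC _ (_ - _), edotC v u) => H.
  rewrite -(ler_pM2l vgt0); lra.
rewrite (le_trans (ler_norm _))// -sqrtr_sqr !enormE -sqrtrM ?edot_ge0//.
by rewrite ler_wsqrtr.
Qed.

End EuclideanGeometry.

Section FirstOrder.
Context {R : realType} {N : nat}.
Implicit Types (f : 'rV[R]_N -> \bar R) (x v : 'rV[R]_N).

Lemma ediffble_fin_num f x : ediffble f x -> f x \is a fin_num.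
Proof. by case=> /nbhs_singleton. Qed.

Lemma derive_edot f x v : ediffble f x ->
  'D_v (fine \o f) x = edot (grad f x) v.
Proof.
case=> _ df; rewrite deriveE// [in LHS](row_sum_delta v) linear_sum.
apply: eq_bigr => i _.
by rewrite linearZ/= mxE deriveE// mulrC.
Qed.

(** The difference quotients of f along the line are literally those of the
directional derivative at the corresponding point, so no chain rule is used. *)
Lemma is_derive_line f x v (s : R) : ediffble f (x + s *: v) ->
  is_derive s 1 (fun r : R => fine (f (x + r *: v)))
    (edot (grad f (x + s *: v)) v).
Proof.
move=> df.
have dv : derivable (fine \o f) (x + s *: v) v by apply: diff_derivable; case: df.
have E : (fun h : R => h^-1 *: (((fun r : R => fine (f (x + r *: v))) \o shift s)
      (h *: 1) - fine (f (x + s *: v)))) =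
    (fun h : R => h^-1 *: (((fine \o f) \o shift (x + s *: v)) (h *: v)
      - (fine \o f) (x + s *: v))).
  apply/funext => h /=; congr (_ *: (fine (f _) - _)).
  by rewrite [h *: 1]mulr1 scalerDl addrCA.
split; first by rewrite /derivable E.
by rewrite -derive_edot// /derive E.
Qed.

(** Along the segment from x to x + v, the slope of f at time r differs from its
initial slope by at most r L |v|^2, by Cauchy-Schwarz and the Lipschitz bound.
Hence f minus its quadratic model is nonincreasing on [0, 1], and comparing its
values at 0 and 1 gives the claim without integration. *)
Lemma descent_lemma f (L : R) x v :
    (forall y, ediffble f y) -> lipschitz_grad L f ->
  fine (f (x + v)) <=
    fine (f x) + edot (grad f x) v + L / 2 * enorm v ^+ 2.
Proof.
move=> df lipf.
set phi := fun r : R => fine (f (x + r *: v)).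
set c := edot (grad f x) v.
set q := L / 2 * enorm v ^+ 2.
pose h := fun r : R => phi r - (c * r + q * r ^+ 2).
have dh (r : R) : is_derive r 1 h
    (edot (grad f (x + r *: v)) v - (c + q * (2 * r))).
  have dphi : is_derive r 1 phi _ := @is_derive_line _ _ _ _ (df _).
  apply: is_derive_eq.
  rewrite /GRing.scale/=; ring.
have h0 (r : R) : r \in `]0, 1[ -> derive1 h r <= 0.
  rewrite in_itv/= => /andP[r0 _]; rewrite derive1E derive_val.
  rewrite subr_le0 -lerBlDl -edotBl.
  apply: (le_trans (edot_le_enormM _ _)).
  have := lipf (x + r *: v) x.
  rewrite addrAC subrr add0r (enormZ _ (ltW r0)) => /(ler_wpM2r (enorm_ge0 v)).
  move=> H; apply: (le_trans H); rewrite le_eqVlt; apply/orP; left; apply/eqP.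
  by rewrite /q; field.
have := @ler0_derive1_le_cc _ h 0 1 _ h0 _ 1 0.
rewrite /h /phi !scale1r !scale0r addr0 expr0n/= expr1n !mulr1 !mulr0 addr0 subr0.
rewrite lerBlDr addrA; apply; rewrite ?in_itv/= ?lexx ?ler01//.
apply: continuous_subspaceT => r.
exact/differentiable_continuous/derivable1_diffP.
Qed.

(** By convexity the difference quotients (f (x + h v) - f x) / h with
0 < h <= 1 are at most f (x + v) - f x; let h tend to 0 from the right. *)
Lemma convex_above_tangent f x v :
    (forall y, ediffble f y) -> econvex f ->
  fine (f x) + edot (grad f x) v <= fine (f (x + v)).
Proof.
move=> df cf; rewrite addrC -lerBrDr.
have [|dphi dval] := @is_derive_line f x v 0; first exact: df.
rewrite scale0r addr0 in dval; rewrite -dval.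
apply: (@cvgr_to_le _ (0 : R)^'+); first exact: cvg_dnbhs_at_right dphi.
near=> h.
have h0 : 0 < h by near: h; exact: nbhs_right_gt.
have h1 : h <= 1 by near: h; exact: nbhs_right_le.
rewrite /= scale0r !addr0 [h *: 1]mulr1 [leLHS]mulrC ler_pdivrMr//.
have := cf (x + v) x h; rewrite (ltW h0) h1 => /(_ isT).
have -> : h *: (x + v) + (1 - h) *: x = x + h *: v.
  by rewrite scalerDr scalerBl scale1r addrC addrA subrK.
have F y : f y = (fine (f y))%:E by rewrite fineK// ediffble_fin_num.
rewrite (F (x + v)) (F x) (F (x + h *: v)) -!EFinM -EFinD lee_fin.
lra.
Unshelve. all: by end_near. Qed.

End FirstOrder.

Section SegmentInConvexSet.
Context {R : realType} {N : nat}.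
Implicit Types (K : set 'rV[R]_N) (x d : 'rV[R]_N).

Lemma convex_set_segment K x d (s t : R) : convex_set K -> K x ->
  0 < t -> K (x - t *: d) -> 0 <= s <= t -> K (x - s *: d).
Proof.
move=> cK Kx t0 Kt /andP[s0 st].
have p0 : 0 <= s / t by rewrite divr_ge0// ltW.
have p1 : s / t <= 1 by rewrite ler_pdivrMr// mul1r.
have := cK (x - t *: d) x (@Itv01 _ (s / t) p0 p1).
rewrite !inE => /(_ Kt Kx).
congr K; rewrite /conv/=.
rewrite scalerBr scalerA divfK ?gt_eqF// scalerBl scale1r.
by rewrite addrC addrA subrK.
Qed.

(** Every s < t lies below some admissible step, hence is admissible by
convexity; t itself follows by letting s tend to t from the left. *)
Lemma closed_convex_step K x d (t : R) : closed K -> convex_set K -> K x ->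
    0 < t ->
    (t%:E <= ereal_sup [set s%:E | s in
       [set s : R | (0 < s)%R /\ (K (x - s *: d))%R]])%E ->
  K (x - t *: d).
Proof.
move=> clK cK Kx t0 tsup.
apply: (@closed_cvg _ _ (t^'-) _ (fun s : R => x - s *: d) K clK).
  near=> s.
  have s0 : 0 < s by near: s; exact: nbhs_left_gt.
  have st : s < t by near: s; exact: nbhs_left_lt.
  have ssup := lt_le_trans (st : (s%:E < t%:E)%E) tsup.
  have [_ [s' [s'0 Ks'] <-]] := ereal_sup_gt ssup.
  rewrite lte_fin => ss'.
  by apply: (convex_set_segment cK Kx s'0 Ks'); rewrite (ltW s0) ltW.
apply: cvg_at_left_filter; apply: cvgB; first exact: cvg_cst.
by apply: cvgZr_tmp.
Unshelve. all: by end_near. Qed.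

End SegmentInConvexSet.

(** The decrease of g - f along a step of length t against the gradient gap d
is at least (t / 2) (2 - t L) |d|^2, and at most 2 eps if |g - f| <= eps at both
ends. *)
Lemma grad_gap_bound (R : realType) (N : nat) (f g : 'rV[R]_N -> \bar R)
    (L eps t : R) (x : 'rV[R]_N) :
    let d := grad g x - grad f x in
    (forall y, ediffble f y) -> econvex f ->
    (forall y, ediffble g y) -> lipschitz_grad L g ->
    `|fine (g x) - fine (f x)| <= eps ->
    `|fine (g (x - t *: d)) - fine (f (x - t *: d))| <= eps ->
  t * (2 - t * L) * enorm d ^+ 2 <= 4 * eps.
Proof.
move=> d df cf dg lipg; rewrite !ler_norml => /andP[_ gx] /andP[gy _].
have := @convex_above_tangent _ _ f x (- t *: d) df cf.
have := @descent_lemma _ _ g L x (- t *: d) dg lipg.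
rewrite !sqr_enorm !edotZr edotZl scaleNr.
have -> : edot d d = edot (grad g x) d - edot (grad f x) d by rewrite -edotBl.
lra.
Qed.

Theorem proposition15 (R : realType) (N : nat)
  (psi : 'rV[R]_N -> \bar R) (Lpsi : R)
  (psi_gtNy : never_ninfty psi)
  (psi_C1 : cont_diff psi)
  (psi_convex : econvex psi)
  (psi_lip : lipschitz_grad Lpsi psi)
  (K : set 'rV[R]_N) (K_compact : compact K) (K_convex : convex_set K)
  (eps : R) (eps_gt0 : 0 < eps)
  (psi_eps : 'rV[R]_N -> \bar R) (Leps : R) (Leps_gt0 : 0 < Leps)
  (psi_eps_gtNy : never_ninfty psi_eps)
  (psi_eps_C1 : cont_diff psi_eps)
  (psi_eps_lip : lipschitz_grad Leps psi_eps)
  (psi_eps_dist : dist_sup K psi_eps psi = eps%:E) :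
  forall x : 'rV[R]_N, K x ->
    (forall t : R, 0 < t -> (t%:E <= rstep K Leps psi psi_eps x)%E ->
      enorm (grad psi_eps x - grad psi x)
        <= 2 * Num.sqrt (eps / t) * (1 / Num.sqrt (2 - t * Leps))) /\
    (rstep K Leps psi psi_eps x = (1 / Leps)%:E ->
      enorm (grad psi_eps x - grad psi x) <= 2 * Num.sqrt (Leps * eps)).
Proof.
move=> x Kx.
have [df _] := psi_C1; have [dg _] := psi_eps_C1.
have gap y : K y -> `|fine (psi_eps y) - fine (psi y)| <= eps.
  move=> Ky; rewrite -lee_fin -psi_eps_dist; apply: ereal_sup_ubound; exists y => //.
  have [dfy dgy] := (df y, dg y).
  by rewrite -(fineK (ediffble_fin_num dfy)) -(fineK (ediffble_fin_num dgy)).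
have bound (t : R) : 0 < t -> (t%:E <= rstep K Leps psi psi_eps x)%E ->
    enorm (grad psi_eps x - grad psi x)
      <= 2 * Num.sqrt (eps / t) * (1 / Num.sqrt (2 - t * Leps)).
  move=> t0; rewrite /rstep le_min lee_fin => /andP[tL].
  rewrite le_max lee_fin (leNgt t 0) t0/= => tsup.
  have tL2 : 0 < 2 - t * Leps by move: tL; rewrite ler_pdivlMr//; lra.
  have Ky := closed_convex_step
    (compact_closed (@norm_hausdorff _ _) K_compact) K_convex Kx t0 tsup.
  have := grad_gap_bound df psi_convex dg psi_eps_lip (gap _ Kx) (gap _ Ky).
  set n := enorm _ => key.
  have n0 : 0 <= n := enorm_ge0 _.
  rewrite div1r -(sqrtrV (ltW tL2)) -mulrA -sqrtrM; last by rewrite divr_ge0// ltW.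
  (* The bound is 2 sqrt (eps / t / (2 - t L)): compare n / 2, seen as the root
     of its square, with that root. *)
  rewrite -ler_pdivrMl//.
  rewrite -[leLHS]ger0_norm ?mulr_ge0 ?invr_ge0// -sqrtr_sqr ler_wsqrtr//.
  rewrite -[leRHS]mulrA -invfM ler_pdivlMr ?mulr_gt0// exprMn exprVn.
  lra.
split=> // rE.
have L0 : 0 < 1 / Leps by rewrite divr_gt0.
apply: (le_trans (bound _ L0 _)); first by rewrite rE.
rewrite div1r invrK mulVf ?gt_eqF// (_ : 2 - 1 = 1) ?sqrtr1; last lra.
by rewrite invr1 !mulr1 [eps * _]mulrC.
Qed.
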